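(* Let $n\ge 3$ be odd, $d,R\in\mathbb{Q}$ with $d\ne0$ and $R$ not a square in $\mathbb{Q}$, $D=d^2-R$. Then $f_n=f_n(Z,d,R)$ is irreducible in $\mathbb{Q}[Z]$ if and only if, for every prime $p$ dividing $n$, the number $(d+\sqrt R)/(d-\sqrt R)$ is not a $p$th power in $\mathbb{Q}(\sqrt R)$.
   Context: For $k\ge1$, $F_k=\sum_{j=0}^{\lfloor k/2\rfloor}(-1)^j\frac{k}{k-j}\binom{k-j}{j}Z^{k-2j}$ (so $2\cos(kx)=F_k(2\cos x)$). For odd $n\ge3$, $d\ne0$, $R$ non-square, $D=d^2-R$: $$f_n(Z,d,R)=\sqrt D^{\,n}F_n(Z/\sqrt D)-2dD^{(n-1)/2}=\sum_{j=0}^{(n-1)/2}(-1)^j\frac{n}{n-j}\binom{n-j}{j}D^jZ^{n-2j}-2dD^{(n-1)/2}.$$ *)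

(* Defs.v *)
From mathcomp Require Import all_boot all_order all_algebra all_field.
Set Implicit Arguments. Unset Strict Implicit. Unset Printing Implicit Defensive.
Import GRing.Theory Num.Theory.
Local Open Scope ring_scope.

Definition Dval (d R : rat) : rat := d ^+ 2 - R.

Definition f_poly (n : nat) (d R : rat) : {poly rat} :=
  \sum_(j < (n.-1)./2.+1)
     (((-1) ^+ j * (n%:R / (n - j)%:R) * ('C(n - j, j))%:R * Dval d R ^+ j)
        *: 'X^(n - 2 * j))
  - (2 * d * Dval d R ^+ ((n.-1)./2))%:P.

Definition sqrtR (R : rat) : algC := sqrtC (ratr R).

Definition is_pth_power_QsqrtR (R : rat) (p : nat) (x : algC) : Prop :=
  exists a b : rat, (ratr a + ratr b * sqrtR R) ^+ p = x.

(* Main.v *)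
(* Put s = sqrt R, K = Q(s), b = d - s, c = (d + s)/(d - s), n = 2m + 3 and let
   t^n = c.  Since f_n(u + v) = u^n + v^n - 2 d D^(m+1) whenever u v = D, the
   number z = b (t^(m+2) + t^(m+1)) is a root of f_n.
   If c is no p-th power in K for p | n, then X^n - c is irreducible over K
   (n being odd), hence z has n distinct conjugates, obtained by replacing t
   with its multiples by n-th roots of unity, and f_n is its minimal polynomial.
   If c = e^p with e in K and n = k p, choose t with t^k = e: then z lies in
   K(t), whose degree over Q is at most 2k < n, so f_n is reducible. *)
Require Import Defs.
From mathcomp Require Import all_boot all_order all_algebra all_field.
From mathcomp Require Import ring zify.
Import GRing.Theory Num.Theory.
Local Open Scope ring_scope.
Set Implicit Arguments. Unset Strict Implicit.

(** * Degrees of n-th roots over a subfield, for odd n *)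

Section Capelli.

Context {F : fieldType} {L : fieldExtType F}.
Implicit Types (K : {subfield L}) (x y t : L).

Lemma det_mxOver K n (A : 'M[L]_n) : A \is a mxOver K -> \det A \in K.
Proof.
move=> /mxOverP AK; apply: rpred_sum => s _.
by rewrite rpredM ?rpredX ?rpredN ?rpred1 // rpred_prod.
Qed.

Lemma horner_mx_mxOver K n (A : 'M[L]_n.+1) (g : {poly L}) :
  A \is a mxOver K -> g \is a polyOver K -> horner_mx A g \is a mxOver K.
Proof.
move=> AK /polyOverP gK; rewrite -[g]coefK poly_def rmorph_sum rpred_sum //= => i _.
rewrite horner_mxZ rmorphXn /= horner_mx_X mxOverZ ?rpredX //; exact: gK.
Qed.

(* The norm of K(x)/K: the determinant of multiplication by y, written as a
   polynomial in the companion matrix of the minimal polynomial of x. *)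
Lemma adjoin_norm K x : exists N : L -> L,
  [/\ {in <<K; x>>%VS, forall y, N y \in K},
      {in <<K; x>>%VS &, {morph N : y z / y * z}},
      {in K, forall c, N c = c ^+ adjoin_degree K x} &
      N x = (-1) ^+ adjoin_degree K x * (minPoly K x)`_0].
Proof.
set r := adjoin_degree K x.
have [A AK charA] : exists2 A : 'M[L]_r, A \is a mxOver K &
    char_poly A = minPoly K x.
  have -> : r = (size (minPoly K x)).-1 by rewrite size_minPoly.
  exists (companionmx (minPoly K x)); last exact/companionmxK/monic_minPoly.
  apply/mxOverP=> i j; rewrite mxE.
  have /polyOverP mK := minPolyOver K x.
  by case: ifP => _; rewrite ?rpredN ?rpred_nat.
(* [adjoin_degree] is a successor by definition; exposing this shape puts A in a ring of matrices,
   as [horner_mx] requires. *)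
rewrite /r /adjoin_degree /= in A AK charA *; set m := (_.-1) in A AK charA *.
(* By Cayley-Hamilton the minimal polynomial of x kills A, so the matrix p(A) depends only on the
   value p(x); multiplicativity of N follows from this. *)
have mxP (p q : {poly L}) : p \is a polyOver K -> q \is a polyOver K ->
    p.[x] = q.[x] -> horner_mx A p = horner_mx A q.
  move=> pK qK /eqP; rewrite -subr_eq0 -hornerN -hornerD => pqx.
  have /dvdpP[u pqE] := minPoly_dvdp (rpredB pK qK) pqx.
  apply/eqP; rewrite -subr_eq0 -rmorphB /= pqE rmorphM /= -charA.
  by rewrite Cayley_Hamilton mulr0.
exists (fun y => \det (horner_mx A (Fadjoin_poly K x y))); split.
- by move=> y _; rewrite det_mxOver ?horner_mx_mxOver ?Fadjoin_polyOver.
- move=> y z yK zK /=; rewrite -det_mulmx -[_ *m _]/(_ * _) -rmorphM /=.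
  congr (\det _); apply: mxP; rewrite ?rpredM ?Fadjoin_polyOver //.
  by rewrite hornerM !Fadjoin_poly_eq // rpredM.
- by move=> c cK; rewrite Fadjoin_polyC // horner_mx_C det_scalar.
- rewrite -charA char_poly_det mulrA -exprMn mulrNN mulr1 expr1n mul1r.
  congr (\det _); rewrite -[RHS]horner_mx_X.
  by apply: mxP; rewrite ?Fadjoin_polyOver ?polyOverX // Fadjoin_poly_eq ?memv_adjoin ?hornerX.
Qed.

Lemma adjoin_norm_exp {K x} {N : L -> L} :
  {in <<K; x>>%VS &, {morph N : y z / y * z}} ->
  {in K, forall c, N c = c ^+ adjoin_degree K x} ->
  {in <<K; x>>%VS, forall y k, N (y ^+ k) = N y ^+ k}.
Proof.
move=> NM NC y yK; elim=> [|k IH]; first by rewrite NC ?rpred1 // expr1n.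
by rewrite !exprS NM ?rpredX // IH.
Qed.

Lemma binomial_dvdp K t n : t ^+ n \in K -> minPoly K t %| 'X^n - (t ^+ n)%:P.
Proof.
move=> tK; apply: minPoly_dvdp; last by rewrite /root !hornerE subrr.
by rewrite rpredB ?rpredX ?polyOverX ?polyOverC.
Qed.

Lemma adjoin_degree_le K t n : (0 < n)%N -> t ^+ n \in K ->
  (adjoin_degree K t <= n)%N.
Proof.
move=> n_gt0 tK; have := dvdp_leq _ (binomial_dvdp tK).
rewrite size_minPoly size_XnsubC // ltnS; apply.
by rewrite -size_poly_gt0 size_XnsubC.
Qed.

Lemma minPoly_binomial K t n : (0 < n)%N -> t ^+ n \in K ->
  adjoin_degree K t = n -> minPoly K t = 'X^n - (t ^+ n)%:P.
Proof.
move=> n_gt0 tK degt.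
apply/eqP; rewrite -eqp_monic ?monic_minPoly ?monicXnsubC //.
by rewrite -dvdp_size_eqp ?binomial_dvdp // size_minPoly size_XnsubC // degt.
Qed.

(* If [K(t) : K] = r < p, the norm of t is a p-th root of (t^p)^r in K, and p
   and r are coprime. *)
Lemma adjoin_degree_prime K t p : prime p -> t ^+ p \in K ->
  (forall c, c \in K -> c ^+ p != t ^+ p) -> adjoin_degree K t = p.
Proof.
move=> p_pr tK nopow; have p_gt0 := prime_gt0 p_pr.
have t0 : t != 0.
  apply: contraTneq (nopow 0 (rpred0 _)) => ->; by rewrite negbK.
have le_rp := adjoin_degree_le p_gt0 tK.
have [//|ne_rp] := eqVneq (adjoin_degree K t) p.
have lt_rp : (adjoin_degree K t < p)%N by rewrite ltn_neqAle ne_rp.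
have [N [NK NM NC _]] := adjoin_norm K t.
have tKt : t \in <<K; t>>%VS by exact: memv_adjoin.
set r := adjoin_degree K t in le_rp lt_rp NC ne_rp.
have r_gt0 : (0 < r)%N by [].
have NtE : N t ^+ p = (t ^+ p) ^+ r by rewrite -(adjoin_norm_exp NM NC) // NC.
have cop : coprime r p.
  by rewrite coprime_sym prime_coprime // gtnNdvd.
have [[u v] /= uv] := coprimeP p r_gt0 cop.
have {}uv : (u * r = v * p + 1)%N by lia.
(* The p-th power of this element of K is (t^p)^(u r - v p), and u r - v p = 1 by Bezout. *)
suff /eqP : (N t ^+ u / (t ^+ p) ^+ v) ^+ p = t ^+ p.
  rewrite (negPf (nopow _ _)) //.
  by apply: rpred_div; apply: rpredX => //; apply: NK.
rewrite expr_div_n [(N t ^+ u) ^+ p]exprAC NtE -!(exprM (t ^+ p)) (mulnC r) uv.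
by rewrite exprD expr1 mulrAC divff ?mul1r // !expf_neq0.
Qed.

(* Vahlen-Capelli for odd n: with a = t^(n/p), an equation a = c^q with c in
   K(a) would, upon taking norms to K, make t^n = N(a) a q-th power in K. *)
Lemma adjoin_degree_binomial n K t : odd n -> t ^+ n \in K ->
  (forall p c, prime p -> (p %| n)%N -> c \in K -> c ^+ p != t ^+ n) ->
  adjoin_degree K t = n.
Proof.
elim/ltn_ind: n K t => n IH K t n_odd tK nopow.
have [n1|n_neq1] := eqVneq n 1%N.
  by apply/eqP; rewrite n1 adjoin_deg_eq1 -[t]expr1 -n1.
have n_gt1 : (1 < n)%N by move: n_odd n_neq1; case: n {IH tK nopow} => [|[]].
pose p := pdiv n; pose k := (n %/ p)%N.
have p_pr : prime p := pdiv_prime n_gt1.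
have nE : n = (k * p)%N by rewrite divnK ?pdiv_dvd.
have k_odd : odd k by move: n_odd; rewrite nE oddM => /andP[].
have p_odd : odd p by move: n_odd; rewrite nE oddM => /andP[].
have ltkn : (k < n)%N by rewrite ltn_Pdiv ?prime_gt1 // ltnW.
have aE : (t ^+ k) ^+ p = t ^+ n by rewrite -exprM -nE.
have dega : adjoin_degree K (t ^+ k) = p.
  apply: adjoin_degree_prime; rewrite ?aE // => c cK.
  by rewrite nopow ?pdiv_dvd.
have degt : adjoin_degree <<K; t ^+ k>>%AS t = k.
  apply: IH => //; first exact: memv_adjoin.
  move=> q c q_pr q_dv cK; apply/eqP => cq.
  have [N [NK NM NC Nx]] := adjoin_norm K (t ^+ k).
  (* The minimal polynomial of t^k is X^p - t^n; as p is odd, (-1)^p cancels the sign of its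
     constant coefficient. *)
  have Na : N (t ^+ k) = t ^+ n.
    rewrite Nx dega (minPoly_binomial (prime_gt0 p_pr) _ dega) aE // coefB coefXn coefC /=.
    rewrite (ltn_eqF (prime_gt0 p_pr)) sub0r -signr_odd p_odd.
    by rewrite expr1 mulN1r opprK.
  have /eqP : N c ^+ q = t ^+ n by rewrite -(adjoin_norm_exp NM NC) // cq Na.
  by rewrite (negPf (nopow _ _ q_pr _ (NK c cK))) // nE dvdn_mulr.
have KtE : <<<<K; t ^+ k>>; t>>%VS = <<K; t>>%VS.
  apply/eqP; rewrite eqEsubv; apply/andP; split.
    apply/FadjoinP; split; last exact: memv_adjoin.
    by apply/FadjoinP; split; [exact: subv_adjoin|rewrite rpredX ?memv_adjoin].
  apply/FadjoinP; split; last exact: memv_adjoin.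
  exact: subv_trans (subv_adjoin _ _) (subv_adjoin _ _).
have := dim_Fadjoin <<K; t ^+ k>>%AS t; rewrite /= KtE !dim_Fadjoin degt dega.
by rewrite mulnA -nE => /eqP; rewrite eqn_pmul2r ?adim_gt0 // => /eqP.
Qed.

End Capelli.

(** * Waring's formula for power sums, and the values of f_n *)

Section Waring.

Context {T : comNzRingType}.
Implicit Types (z D u v : T).

(** Terms of the Dickson polynomial of the second kind: for z = u + v and D = u v, their sum is u^n
    + u^(n-1) v + ... + v^n. It has integer coefficients, unlike the quotients n/(n-j) in f_n, so it
    makes sense over any commutative ring. *)
Definition fib_term z D (n j : nat) : T :=
  (-1) ^+ j * 'C(n - j, j)%:R * D ^+ j * z ^+ (n - 2 * j).

Definition fib_sum z D n := \sum_(j < n.+1) fib_term z D n j.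

Lemma fib_term0 z D n j : (n < 2 * j)%N -> fib_term z D n j = 0.
Proof. by move=> nj; rewrite /fib_term bin_small ?mulr0 ?mul0r //; lia. Qed.

(** Terms with 2j > n vanish with their binomial, so the cutoff can be chosen to align sums of
    different index. *)
Lemma fib_sum_widen z D n N : (n <= 2 * N + 1)%N ->
  fib_sum z D n = \sum_(j < N.+1) fib_term z D n j.
Proof.
move=> nN; rewrite /fib_sum; pose M := maxn n N.
have trunc k : (k <= M)%N -> (n <= 2 * k + 1)%N ->
    \sum_(j < M.+1) fib_term z D n j = \sum_(j < k.+1) fib_term z D n j.
  move=> kM nk; rewrite (@big_ord_widen _ _ _ k.+1 M.+1 (fib_term z D n)) //.
  rewrite [RHS]big_mkcond; apply: eq_bigr => j _; case: ifP => // jk.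
  by rewrite fib_term0 //; lia.
by rewrite -!trunc //; lia.
Qed.

Lemma fib_termS z D n j :
  fib_term z D n.+2 j.+1 = z * fib_term z D n.+1 j.+1 - D * fib_term z D n j.
Proof.
have [lt_nj|le_jn] := ltnP n (2 * j).
  by rewrite !fib_term0 ?mulr0 ?subr0 //; lia.
rewrite /fib_term (_ : n.+2 - j.+1 = (n - j).+1)%N; last by lia.
rewrite (_ : n.+1 - j.+1 = n - j)%N; last by lia.
rewrite (_ : n.+2 - 2 * j.+1 = n - 2 * j)%N; last by lia.
rewrite binS natrD; have [lt_jn|le_nj] := ltnP (2 * j) n.
  rewrite (_ : n - 2 * j = (n.+1 - 2 * j.+1).+1)%N; last by lia.
  by rewrite !exprS; ring.
(* Here n = 2j: the exponent of z in [fib_term z D n.+1 j.+1] is truncated to 0, harmlessly because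
   the binomial is 0. *)
rewrite ['C(n - j, j.+1)]bin_small; last by lia.
by rewrite !exprS; ring.
Qed.

Lemma fib_sumS z D n :
  fib_sum z D n.+2 = z * fib_sum z D n.+1 - D * fib_sum z D n.
Proof.
rewrite (@fib_sum_widen z D n.+2 n.+1) ?(@fib_sum_widen z D n.+1 n.+1); try lia.
rewrite big_ord_recl [X in z * X]big_ord_recl /= /fib_sum mulrDr !mulr_sumr.
rewrite -addrA -sumrB.
congr (_ + _); first by rewrite /fib_term !bin0 !muln0 !subn0 [z ^+ n.+2]exprS; ring.
by apply: eq_bigr => j _; rewrite fib_termS.
Qed.

(** Both sides satisfy a(k+2) = (u + v) a(k+1) - u v a(k), so the induction carries two consecutive
    values. *)
Lemma fib_sum_powers u v n :
  fib_sum (u + v) (u * v) n.+2 - u * v * fib_sum (u + v) (u * v) n =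
  u ^+ n.+2 + v ^+ n.+2.
Proof.
pose P k := fib_sum (u + v) (u * v) k.+2 - u * v * fib_sum (u + v) (u * v) k =
  u ^+ k.+2 + v ^+ k.+2.
suff [//] : P n /\ P n.+1.
have E0 : fib_sum (u + v) (u * v) 0 = 1.
  by rewrite /fib_sum big_ord1 /fib_term !expr0 !mulr1.
have E1 : fib_sum (u + v) (u * v) 1 = u + v.
  rewrite /fib_sum !big_ord_recl big_ord0 /fib_term /= bin0 bin_small //.
  by rewrite !expr0 expr1; ring.
rewrite /P; elim: n => [|n [IH0 IH1]].
  by split; rewrite !fib_sumS E0 E1 !exprS; ring.
split=> //; move: IH0 IH1; rewrite [_ _ n.+4]fib_sumS.
set a := fib_sum _ _ n.+3; set b := fib_sum _ _ n.+2.
rewrite {}/b; rewrite [in X in _ -> _ -> _ - _ * X = _]fib_sumS.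
set b := fib_sum _ _ n.+2; set c := fib_sum _ _ n.+1; set e := fib_sum _ _ n.
move=> IH0 IH1.
transitivity ((u + v) * (a - u * v * c) - u * v * (b - u * v * e)); first by ring.
by rewrite IH0 IH1 !exprS; ring.
Qed.

End Waring.

(** Write i = j + 1 and n = (n - i) + i, then absorb i/(n - i) into the binomial. This splits each
    coefficient of f_n beyond the leading one between the two sums of [fib_sum_powers]. *)
Lemma lucas_coef (n j : nat) : (j.+1 < n)%N ->
  n%:R / (n - j.+1)%:R * 'C(n - j.+1, j.+1)%:R =
    'C(n - j.+1, j.+1)%:R + 'C(n - 2 - j, j)%:R :> rat.
Proof.
move=> jn; rewrite (_ : n - 2 - j = (n - j.+1).-1)%N; last by lia.
have k0 : (n - j.+1)%:R != 0 :> rat by rewrite pnatr_eq0; lia.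
have := mul_bin_diag (n - j.+1) j => /(congr1 (fun k => k%:R : rat)).
rewrite !natrM => bE; apply: (mulfI k0); rewrite mulrDr bE.
have -> : n%:R = (n - j.+1)%:R + j.+1%:R :> rat by rewrite -natrD subnK // ltnW.
by field.
Qed.

Lemma f_poly_eval (L : fieldExtType rat) (m : nat) (d R : rat) (u v : L) :
  u * v = (Dval d R)%:A ->
  (map_poly (in_alg L) (f_poly (2 * m).+3 d R)).[u + v] =
    u ^+ (2 * m).+3 + v ^+ (2 * m).+3 - (2 * d * Dval d R ^+ m.+1)%:A.
Proof.
move=> uvE; rewrite -fib_sum_powers /f_poly.
rewrite (_ : ((2 * m).+3.-1)./2 = m.+1)%N; last by lia.
rewrite rmorphB /= map_polyC /= hornerD hornerN hornerC; congr (_ - _).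
rewrite rmorph_sum horner_sum /= uvE; move: (Dval d R) => D.
(* The second sum gets one term fewer: once the leading terms are split off, its term j meets the
   terms j + 1 of f_n and of the first sum. *)
rewrite (@fib_sum_widen _ _ _ _ m.+1) ?(@fib_sum_widen _ _ _ (2 * m).+1 m); try lia.
rewrite big_ord_recl [X in _ = X - _]big_ord_recl /= mulr_sumr -addrA -sumrB; congr (_ + _).
  rewrite /fib_term !subn0 !bin0 divff ?pnatr_eq0 //.
  by rewrite !expr0 !mulr1 scale1r map_polyXn hornerXn mul1r.
apply: eq_bigr => j _; rewrite /bump /= add1n.
rewrite linearZ /= map_polyXn hornerZ hornerXn /fib_term.
rewrite -[_ * (_ / _) * _]mulrA lucas_coef; last by have := ltn_ord j; lia.
rewrite -!in_algE !(rmorphM, rmorphD, rmorphXn, rmorphN, rmorph1, rmorph_nat) /=.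
rewrite (_ : (2 * m).+3 - 2 = (2 * m).+1)%N; last by lia.
rewrite (_ : (2 * m).+1 - 2 * j = (2 * m).+3 - 2 * j.+1)%N; last by lia.
by rewrite !exprS; ring.
Qed.

Lemma size_f_poly (n : nat) (d R : rat) :
  (0 < n)%N -> odd n -> size (f_poly n d R) = n.+1.
Proof.
move=> n0 n_odd; rewrite /f_poly big_ord_recl /= !expr0 bin0 ?muln0 !subn0.
rewrite divff ?pnatr_eq0 -?lt0n // !mulr1 scale1r -addrA size_polyDl ?size_polyXn //.
rewrite ltnS (leq_trans (size_polyD _ _)) // geq_max; apply/andP; split.
  apply: (leq_trans (size_sum _ _ _)); apply/bigmax_leqP => j _.
  apply: (leq_trans (size_scale_leq _ _)); rewrite size_polyXn /bump /=.
  by have := ltn_ord j; lia.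
by rewrite size_polyN (leq_trans (size_polyC_leq1 _)).
Qed.

(** The pairs (x^(m+1), x^m) and (y^(m+1), y^m) have the same sum and the same product c, so they
    agree up to order. In the same order, division gives x = y. *)
Lemma power_sum_inj (L : fieldType) (m : nat) (c x y : L) :
  c != 0 -> c != 1 ->
  x ^+ (2 * m).+1 = c -> y ^+ (2 * m).+1 = c ->
  x ^+ m.+1 + x ^+ m = y ^+ m.+1 + y ^+ m -> x = y.
Proof.
move=> c0 c1 xc yc xy.
have prodE t : t ^+ (2 * m).+1 = c -> t ^+ m.+1 * t ^+ m = c.
  by move=> <-; rewrite -exprD; congr (_ ^+ _); lia.
have t0 t : t ^+ (2 * m).+1 = c -> t != 0.
  by apply: contra_eqN => /eqP ->; rewrite expr0n /= eq_sym.
have : (x ^+ m.+1 - y ^+ m.+1) * (x ^+ m.+1 - y ^+ m) = 0.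
  transitivity (x ^+ m.+1 * (x ^+ m.+1 + x ^+ m - (y ^+ m.+1 + y ^+ m))
    - (x ^+ m.+1 * x ^+ m - y ^+ m.+1 * y ^+ m)); first by ring.
  by rewrite !prodE // xy; ring.
move/eqP; rewrite mulf_eq0 !subr_eq0 => /orP[] /eqP uE.
  have vE : x ^+ m = y ^+ m by move/eqP: xy; rewrite uE => /eqP/addrI.
  by move: uE; rewrite !exprS vE => /mulIf; apply; rewrite expf_neq0 ?t0.
(* In the crossed case x^(m+1) = y^m; raising to the power 2m + 1 gives c^(m+1) = c^m, hence c =
   1. *)
have /eqP[] := c1; apply: (mulIf (expf_neq0 m c0)); rewrite mul1r -exprS.
rewrite -{1}xc -{1}yc -!exprM mulnC exprM uE -exprM.
by congr (_ ^+ _); rewrite mulnC.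
Qed.

(** * The root z of f_n in an extension of K = Q(s) *)

Section RootField.

Context {L : fieldExtType rat}.
Implicit Types (b s t z : L) (K : {subfield L}).

(** Supplies the rational coordinates that [is_pth_power_QsqrtR] asks for. *)
Lemma quadratic_mem (s c : L) : s ^+ 2 \in 1%VS -> c \in <<1; s>>%VS ->
  exists x y : rat, c = x%:A + y%:A * s.
Proof.
move=> s2 cK; have p1 := Fadjoin_polyOver 1 s c.
have szp : (size (Fadjoin_poly 1 s c) <= 2)%N.
  exact: leq_trans (size_Fadjoin_poly _ _ _) (adjoin_degree_le _ s2).
rewrite -(Fadjoin_poly_eq cK) (horner_coef_wide _ szp) !big_ord_recl big_ord0 /=.
have /vlineP[x ->] := polyOverP p1 0%N; have /vlineP[y ->] := polyOverP p1 1%N.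
by exists x, y; rewrite !mulr1 addr0.
Qed.

Context {d R : rat} {s : L}.
Hypotheses (sR : s ^+ 2 = R%:A) (Rnsq : forall q : rat, q ^+ 2 != R).

Let K := <<1; s>>%AS.
Let b : L := d%:A - s.
Let c : L := (d%:A + s) / b.

Lemma sqrt_nonrational q : s != q%:A.
Proof.
apply: contraNneq (Rnsq q) => sq; move: sR; rewrite sq -in_algE -rmorphXn /=.
by move/(fmorph_inj (in_alg L)) => ->.
Qed.

Lemma s_neq0 : s != 0.
Proof. by have := sqrt_nonrational 0; rewrite scale0r. Qed.

Lemma denom_neq0 : b != 0.
Proof. by rewrite subr_eq0 eq_sym sqrt_nonrational. Qed.

Lemma ratio_neq0 : c != 0.
Proof.
rewrite mulf_neq0 ?invr_eq0 ?denom_neq0 // addrC -[d%:A]opprK subr_eq0.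
by rewrite -scaleNr sqrt_nonrational.
Qed.

Lemma ratio_neq1 : c != 1.
Proof.
apply: contraTneq s_neq0 => /(canRL (divfK denom_neq0)); rewrite mul1r => /addrI.
move/eqP; rewrite -subr_eq0 opprK -mulr2n -mulr_natr mulf_eq0.
rewrite -(rmorph_nat (in_alg L)) fmorph_eq0 pnatr_eq0 orbF => /eqP ->.
by rewrite eqxx.
Qed.

Lemma denom_ratio_mem : b \in K /\ c \in K.
Proof.
have sK : s \in K by exact: memv_adjoin.
have dK : d%:A \in K by rewrite rpredZ ?rpred1.
by split; rewrite ?rpred_div ?rpredD ?rpredN.
Qed.

Context {m : nat} {t : L}.
Let n := (2 * m).+3.
Hypothesis tc : t ^+ n = c.
Let z := b * (t ^+ m.+2 + t ^+ m.+1).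

(** Take u = b t^(m+2) and v = b t^(m+1). Then u v = b^2 c = D, and u^n + v^n = b^n c^(m+1) (c + 1)
    = 2 d D^(m+1), since b (c + 1) = 2d. *)
Lemma f_poly_root : root (map_poly (in_alg L) (f_poly n d R)) z.
Proof.
have b0 := denom_neq0.
have Dab : (d%:A + s) * b = (Dval d R)%:A.
  rewrite /b /Dval scalerBl -sR -[(d ^+ 2)%:A]/(in_alg L _) rmorphXn /=; ring.
have nE : n = (m.+2 + m.+1)%N by rewrite /n; lia.
rewrite /root /z mulrDr f_poly_eval; last first.
  rewrite mulrACA -exprD -nE tc -Dab /c.
  by rewrite -mulrA [b * (_ / _)]mulrC divfK // mulrC.
have pw k : (b * t ^+ k) ^+ n = b ^+ n * c ^+ k.
  by rewrite exprMn exprAC tc.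
have -> : (2 * d * Dval d R ^+ m.+1)%:A = 2 * d%:A * ((d%:A + s) * b) ^+ m.+1.
  by rewrite Dab -[LHS]/(in_alg L _) !rmorphM rmorphXn rmorph_nat.
rewrite -/n !pw /c nE exprD !expr_div_n.
have bm : b ^+ m != 0 by rewrite expf_neq0.
rewrite !exprS exprMn; apply/eqP.
(* Eliminating d leaves a rational identity in the free variables b and s. *)
have : d%:A = b + s by rewrite /b; ring.
move: (d%:A) (b) b0 bm (s) => d' b' b0 bm s' ->.
by field; rewrite b0 bm.
Qed.

(* The K-conjugates of t are its multiples by powers of w, so g vanishes at the
   n values of Zp there, distinct by power_sum_inj. *)
Lemma rat_poly_size_gt (w : L) (g : {poly rat}) : n.-primitive_root w ->
  adjoin_degree K t = n -> g != 0 ->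
  root (map_poly (in_alg L) g) z -> (n < size g)%N.
Proof.
move=> w_prim degt g0 gz; have [bK cK] := denom_ratio_mem.
pose Zp : {poly L} := b%:P * ('X^(m.+2) + 'X^(m.+1)).
have ZpE y : Zp.[y] = b * (y ^+ m.+2 + y ^+ m.+1) by rewrite !hornerE.
have ZpK : Zp \is a polyOver K.
  by rewrite rpredM ?rpredD ?rpredX ?polyOverX ?polyOverC.
have gzK : map_poly (in_alg L) g \Po Zp \is a polyOver K.
  by rewrite polyOver_comp ?alg_polyOver.
have dv : 'X^n - (t ^+ n)%:P %| map_poly (in_alg L) g \Po Zp.
  rewrite -(minPoly_binomial _ _ degt) ?tc // minPoly_dvdp //.
  by rewrite /root horner_comp ZpE.
have wt i : (t * w ^+ i) ^+ n = c.
  by rewrite exprMn tc exprAC (prim_expr_order w_prim) expr1n mulr1.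
have t0 : t != 0.
  by apply: contra_eqN tc => /eqP ->; rewrite expr0n /= eq_sym ratio_neq0.
rewrite -(size_map_poly (in_alg L)).
rewrite -(size_iota 0 n) -(size_map (fun i => Zp.[t * w ^+ i])).
apply: max_poly_roots; first by rewrite map_poly_eq0.
  apply/allP => _ /mapP[i _ ->]; rewrite /root -horner_comp.
  have /dvdpP[u ->] := dv; rewrite hornerM !hornerE wt tc subrr mulr0.
  exact: eqxx.
rewrite map_inj_in_uniq ?iota_uniq // => i j; rewrite !mem_iota /= !add0n => ltin ltjn.
rewrite !ZpE => /(mulfI denom_neq0).
have n' : n = (2 * m.+1).+1 by rewrite /n; lia.
move=> /(power_sum_inj ratio_neq0 ratio_neq1).
rewrite -n' !wt => /(_ erefl erefl) /(mulfI t0) /eqP.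
by rewrite (eq_prim_root_expr w_prim) !modn_small // => /eqP.
Qed.

(** In any factorization of f_n, one factor vanishes at z and so has the full degree n; the other is
    then constant. *)
Lemma f_poly_irreducible (w : L) : n.-primitive_root w ->
  adjoin_degree K t = n -> irreducible_poly (f_poly n d R).
Proof.
move=> w_prim degt; have szf : size (f_poly n d R) = n.+1.
  by rewrite size_f_poly // /n; lia.
have f0 : f_poly n d R != 0 by rewrite -size_poly_gt0 szf.
split=> [|q q1 qf]; first by rewrite szf.
have [p fE] := dvdpP _ _ qf.
have [p0 q0] : p != 0 /\ q != 0.
  by apply/andP; rewrite -negb_or -mulf_eq0 -fE.
have sz : (size p + size q = n.+2)%N.
  have := size_mul p0 q0; rewrite -fE szf.
  have : (0 < size p)%N by rewrite size_poly_gt0.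
  by case: (size p) => // a _ /= ->.
have := f_poly_root; rewrite fE rmorphM /= rootM => /orP[].
  move/(rat_poly_size_gt w_prim degt p0) => szp.
  case/negP: q1; rewrite eqn_leq size_poly_gt0 q0 andbT.
  by rewrite -(leq_add2l (size p)) sz addn1 ltnS.
move/(rat_poly_size_gt w_prim degt q0) => szq.
rewrite -fE -dvdp_size_eqp // szf eqn_leq szq andbT -szf.
by rewrite dvdp_leq.
Qed.

(* [Q(z) : Q] divides [K(t) : Q] <= 2k < n. *)
Lemma f_poly_reducible (k p : nat) : n = (k * p)%N -> (2 < p)%N -> t ^+ k \in K ->
  ~ irreducible_poly (f_poly n d R).
Proof.
move=> nE p_gt2 tkK [_ irr]; have [bK _] := denom_ratio_mem.
have k_gt0 : (0 < k)%N by move: nE; rewrite /n; case: (k).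
have degs : (adjoin_degree 1 s <= 2)%N.
  by rewrite adjoin_degree_le // sR rpredZ ?rpred1.
have degz : (adjoin_degree 1 z <= 2 * k)%N.
  have zK : (<<1; z>> <= <<K; t>>)%VS.
    apply/FadjoinP; split; first exact: sub1v.
    have tKt : t \in <<K; t>>%VS := memv_adjoin _ _.
    have bKt : b \in <<K; t>>%VS by apply: (subvP (subv_adjoin K t)).
    by apply: rpredM => //; apply: rpredD; apply: rpredX.
  have degzt : (adjoin_degree 1 z <= adjoin_degree K t * adjoin_degree 1 s)%N.
    by have := dimvS zK; rewrite !dim_Fadjoin dimv1 !muln1.
  by rewrite (leq_trans degzt) // mulnC leq_mul // adjoin_degree_le.
(* The minimal polynomial of z divides f_n; if f_n were irreducible, the degrees would agree, giving
   k p <= 2 k. *)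
have /polyOver1P[q qE] := minPolyOver 1 z.
have szq : size q = (adjoin_degree 1 z).+1.
  by rewrite -(size_map_poly (in_alg L)) -qE size_minPoly.
have qf : q %| f_poly n d R.
  by rewrite -(dvdp_map (in_alg L)) -qE minPoly_dvdp ?alg_polyOver ?f_poly_root.
have := irr q; rewrite szq qf => /(_ isT isT)/eqp_size.
rewrite szq size_f_poly //; last by rewrite /n; lia.
move=> [degn]; have : (k * p <= 2 * k)%N by rewrite -nE /n -degn.
by rewrite mulnC leq_pmul2r // leqNgt p_gt2.
Qed.

End RootField.

(** * Transfer between algebraic numbers and a number field *)

Unset Implicit Arguments.

Theorem theorem2 (n : nat) (d R : rat) :
  (3 <= n)%N -> odd n -> d != 0 -> (forall q : rat, q ^+ 2 != R) ->
  irreducible_poly (f_poly n d R) <->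
  (forall p : nat, prime p -> (p %| n)%N ->
     ~ is_pth_power_QsqrtR R p
         ((ratr d + sqrtR R) / (ratr d - sqrtR R))).
Proof.
move=> n_ge3 n_odd d0 Rnsq.
have [m nE] : exists m, n = (2 * m).+3 by exists (n.-2./2); lia.
pose S := sqrtR R.
have S2 : S ^+ 2 = ratr R by rewrite sqrtCK.
split=> [irr p p_pr p_dv [x [y xyE]]|nopow].
(* This [c] is the p-th root x + y sqrt R of the ratio, not the ratio itself; a k-th root t of it
   satisfies t^n = (d + s)/(d - s). *)
- set c := _ + _ in xyE; pose k := (n %/ p)%N.
  have nkp : n = (k * p)%N by rewrite divnK.
  have k_gt0 : (0 < k)%N by move: n_ge3; rewrite nkp; case: (k).
  have [L [LC [[|s [|t [|? ?]]] //= [sE tE] _]]] := num_field_exists [:: S; k.-root c].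
  have sR : s ^+ 2 = R%:A.
    by apply: (fmorph_inj LC); rewrite rmorphXn sE S2 alg_num_field fmorph_rat.
  have tk : t ^+ k = x%:A + y%:A * s.
    apply: (fmorph_inj LC); rewrite rmorphXn rmorphD rmorphM /= tE sE rootCK //.
    by rewrite !alg_num_field !fmorph_rat.
  have tn : t ^+ (2 * m).+3 = (d%:A + s) / (d%:A - s).
    apply: (fmorph_inj LC); rewrite -nE nkp exprM tk.
    rewrite rmorphXn fmorph_div rmorphB !rmorphD rmorphM /= sE.
    by rewrite !alg_num_field !fmorph_rat.
  rewrite nE in irr.
  apply: (f_poly_reducible sR Rnsq tn (k := k) (p := p)) (irr); first by rewrite -nE.
    have : odd p by apply: dvdn_odd n_odd.
    by have := prime_gt1 p_pr; case: (p) => [|[|[]]].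
  rewrite tk rpredD ?rpredM ?memv_adjoin //; apply: subvP (subv_adjoin _ _) _ _;
    exact: rpredZ (rpred1 _).
have [w w_prim] := C_prim_root_exists (ltnW (ltnW n_ge3)).
set c := _ / _ in nopow.
(* The root of unity is put in L but not in K, so L contains all n conjugates of t while the degree
   of t is still taken over Q(s). *)
have [L [LC [[|s [|t [|w' [|? ?]]]] //= [sE tE wE] _]]] :=
  num_field_exists [:: S; n.-root c; w].
have sR : s ^+ 2 = R%:A.
  by apply: (fmorph_inj LC); rewrite rmorphXn sE S2 alg_num_field fmorph_rat.
have cE : LC ((d%:A + s) / (d%:A - s)) = c.
  by rewrite fmorph_div rmorphB rmorphD /= sE !alg_num_field !fmorph_rat.
have tn : t ^+ n = (d%:A + s) / (d%:A - s).
  by apply: (fmorph_inj LC); rewrite cE rmorphXn tE rootCK // ltnW // ltnW.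
have w'_prim : n.-primitive_root w' by rewrite -(fmorph_primitive_root LC) wE.
rewrite nE in tn w'_prim *; apply: (f_poly_irreducible sR Rnsq tn w'_prim).
rewrite -nE in tn w'_prim *; apply: adjoin_degree_binomial => //.
  rewrite tn; by have [] := denom_ratio_mem (d := d) (s := s).
move=> p e p_pr p_dv eK; apply/eqP => ep.
apply: nopow p_pr p_dv _.
have s2 : s ^+ 2 \in 1%VS by rewrite sR rpredZ ?rpred1.
have [x [y eE]] := quadratic_mem s2 eK; exists x, y.
rewrite -cE -tn -ep rmorphXn eE rmorphD rmorphM /= sE.
by rewrite !alg_num_field !fmorph_rat.
Qed.
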